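(* Let $n\ge 4$ be an integer. If a graph $G$ has no induced subgraph isomorphic to $P_n$ or to $K_{\lceil n/2\rceil}\triangleright S_{\lceil n/2\rceil}$, then \[\chi(G)\le (n-3)^{\lceil n/2\rceil-1}\,\omega(G)^{\lceil n/2\rceil-1}.\]
   Context: $P_n$ is the path graph on $n$ vertices. For a positive integer $m$, $K_m\triangleright S_m$ denotes the graph on $2m$ vertices $a_1,\dots,a_m,b_1,\dots,b_m$ in which $\{a_1,\dots,a_m\}$ is a clique, $\{b_1,\dots,b_m\}$ is a stable set, and for all $1\le i,j\le m$, $a_i$ is adjacent to $b_j$ if and only if $i\ge j$. $\omega(G)$ is the clique number and $\chi(G)$ the chromatic number. *)

(* Defs.v *)
From mathcomp Require Import all_boot.

Set Implicit Arguments.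
Unset Strict Implicit.
Unset Printing Implicit Defensive.

Record sgraph : Type := SGraph {
  vertex :> finType;
  adj : rel vertex;
  adj_sym : symmetric adj;
  adj_irrefl : irreflexive adj
}.

Section Induced.
Variables (G : sgraph) (S : {set G}).

Definition induced_adj : rel {x : G | x \in S} :=
  fun x y => adj (val x) (val y).

Lemma induced_sym : symmetric induced_adj.
Proof. by move=> x y; exact: adj_sym. Qed.

Lemma induced_irrefl : irreflexive induced_adj.
Proof. by move=> x; exact: adj_irrefl. Qed.

Definition induced : sgraph := SGraph induced_sym induced_irrefl.

End Induced.

Definition isomorphic (G H : sgraph) : Prop :=
  exists2 f : G -> H, bijective f & forall x y, adj (f x) (f y) = adj x y.

Definition has_induced (G H : sgraph) : Prop :=
  exists S : {set G}, isomorphic (induced S) H.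

Definition path_adj (n : nat) : rel 'I_n :=
  fun i j => (i.+1 == j :> nat) || (j.+1 == i :> nat).

Lemma path_sym n : symmetric (@path_adj n).
Proof. by move=> i j; rewrite /path_adj orbC. Qed.

Lemma path_irrefl n : irreflexive (@path_adj n).
Proof. by move=> i; rewrite /path_adj orbb eqn_leq ltnn. Qed.

Definition path_graph (n : nat) : sgraph :=
  SGraph (@path_sym n) (@path_irrefl n).

(* [inl i] is a_(i+1) and [inr j] is b_(j+1); shifting both indices by one
   does not affect the comparison of i and j. *)
Definition clique_stable_adj (m : nat) : rel ('I_m + 'I_m) :=
  fun u v => match u, v with
  | inl i, inl j => i != j
  | inl i, inr j => j <= i
  | inr j, inl i => j <= i
  | inr _, inr _ => false
  end.

Lemma clique_stable_sym m : symmetric (@clique_stable_adj m).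
Proof. by case=> i [] j //=; rewrite eq_sym. Qed.

Lemma clique_stable_irrefl m : irreflexive (@clique_stable_adj m).
Proof. by case=> i //=; rewrite eqxx. Qed.

Definition clique_stable_graph (m : nat) : sgraph :=
  SGraph (@clique_stable_sym m) (@clique_stable_irrefl m).

Section Invariants.
Variable G : sgraph.

Definition clique (S : {set G}) : bool :=
  [forall x in S, forall y in S, (x != y) ==> adj x y].

Definition clique_number : nat := \max_(S : {set G} | clique S) #|S|.

Definition colorable (k : nat) : bool :=
  [exists c : {ffun G -> 'I_k}, forall x, forall y, adj x y ==> (c x != c y)].

Lemma colorable_exists : exists k, colorable k.
Proof.
exists #|G|; apply/existsP; exists [ffun x => enum_rank x].
apply/forallP=> x; apply/forallP=> y; apply/implyP=> xy.
rewrite !ffunE (inj_eq enum_rank_inj).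
by apply: contraTneq xy => ->; rewrite adj_irrefl.
Qed.

Definition chromatic_number : nat := ex_minn colorable_exists.

End Invariants.

(* Main.v *)
(** Write g for the bound of the theorem at m - 1 in place of m.  In
    K_m |> S_m the vertex a_m is adjacent to everything, b_m only to a_m, and
    deleting both leaves K_(m-1) |> S_(m-1); so in a K_m |> S_m-free graph
    N(u) \ N(v) is K_(m-1) |> S_(m-1)-free for every edge uv, hence g-colorable
    by induction on m.  A maximal clique K of N(v) shows that N(v) is the union
    of the sets N(v) \ N(y), y in K, so N(v) is (omega - 1) g-colorable.
    Finally, grow an induced path as in Gyarfas' argument: each step discards
    the neighbors of the current end u in the current connected set C; since C
    misses the neighborhood of the predecessor v of u, they lie in N(u) \ N(v)
    and cost only g colors.  Without an induced P_n this gives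
    chi <= (omega - 1) g + (n - 3) g <= (n - 3) omega g. *)
Require Import Defs.
From mathcomp Require Import all_boot zify.

Set Implicit Arguments.
Unset Strict Implicit.
Unset Printing Implicit Defensive.

(** * Induced copies inside a vertex set *)

(** Keeping the ambient graph [G] fixed and varying only [S] lets the inductions run over subsets,
    without nested induced subgraphs. *)
Definition embeds (G : sgraph) (S : {set G}) (H : sgraph) : Prop :=
  exists f : H -> G, [/\ injective f, forall x, f x \in S
                       & forall x y, adj (f x) (f y) = adj x y].

Lemma embeds_has_induced (G H : sgraph) (S : {set G}) :
  embeds S H -> has_induced G H.
Proof.
case=> f [f_inj _ f_adj]; exists [set f x | x : H].
have ex (u : induced [set f x | x : H]) : exists x, f x == val u.
  by have /imsetP[x _ ->] := valP u; exists x.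
have fK u : f (xchoose (ex u)) = val u by apply/eqP; exact: xchooseP (ex u).
exists (fun u => xchoose (ex u)); last by move=> u v; rewrite -f_adj !fK.
exists (fun x => Sub (f x) (imset_f f (isT : x \in H))).
  by move=> u; apply: val_inj; rewrite /= fK.
by move=> x; apply: f_inj; rewrite fK.
Qed.

(** * Colorings of vertex subsets *)

Section SetColoring.
Variable G : sgraph.
Implicit Types (S A B C D : {set G}) (u v x y : G) (g k m n w : nat).

Local Notation col S k := (colorable (@induced G S) k).

(** Total functions into [nat] free colorings of the subtype, so that colorings of different subsets
    can be glued. *)
Lemma colorable_inducedP S k :
  reflect (exists c : G -> nat,
             {in S, forall x, c x < k} /\
             {in S &, forall x y, adj x y -> c x != c y})
          (col S k).
Proof.
apply: (iffP existsP) => [[c /forallP cP]|[c [ck cP]]].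
  pose d x := if insub x is Some u then c u : nat else 0.
  have dE x (xS : x \in S) : d x = c (Sub x xS) by rewrite /d insubT.
  exists d; split=> [x xS|x y xS yS xy]; first by rewrite (dE x xS).
  rewrite (dE x xS) (dE y yS).
  by have /forallP/(_ (Sub y yS))/implyP := cP (Sub x xS); apply.
exists [ffun u => Ordinal (ck (val u) (valP u))].
apply/forallP => u; apply/forallP => v; apply/implyP => uv.
by rewrite !ffunE -val_eqE /=; apply: cP uv; exact: valP.
Qed.

Lemma sub_colorable A S k l : A \subset S -> k <= l -> col S k -> col A l.
Proof.
move=> /subsetP AS kl /colorable_inducedP[c [ck cP]].
apply/colorable_inducedP; exists c; split=> [x /AS xS|x y /AS xS /AS].
  exact: leq_trans (ck x xS) kl.
exact: cP.
Qed.

Lemma colorable_set0 k : col set0 k.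
Proof. by apply/colorable_inducedP; exists (fun=> 0); split=> x; rewrite inE. Qed.

Lemma colorable_set1 v k : 0 < k -> col [set v] k.
Proof.
move=> k0; apply/colorable_inducedP; exists (fun=> 0); split=> // x y.
by rewrite !inE => /eqP-> /eqP->; rewrite adj_irrefl.
Qed.

Lemma colorable_setU A B k l : col A k -> col B l -> col (A :|: B) (k + l).
Proof.
move=> /colorable_inducedP[c [ck cP]] /colorable_inducedP[d [dl dP]].
apply/colorable_inducedP; exists (fun x => if x \in A then c x else k + d x).
split=> [x|x y]; rewrite !inE.
  case: ifP => [xA _|_ /= xB]; first by have := ck x xA; lia.
  by have := dl x xB; lia.
case: ifP => [xA|_] /=; case: ifP => [yA|_] /= xB yB xy.
- exact: cP.
- by have := ck x xA; lia.
- by have := ck y yA; lia.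
- by rewrite eqn_add2l dP.
Qed.

Lemma colorable_bigcup (I : eqType) (s : seq I) (F : I -> {set G}) k :
  {in s, forall i, col (F i) k} -> col (\bigcup_(i <- s) F i) (size s * k).
Proof.
elim: s => [|i s IH] Fk; first by rewrite big_nil colorable_set0.
rewrite big_cons mulSn; apply: colorable_setU; first exact/Fk/mem_head.
by apply: IH => j js; apply: Fk; rewrite inE js orbT.
Qed.

(** * Connected sets and components *)

(** Connectivity in cut form, which directly yields the edges used below; the empty set counts as
    connected. *)
Definition connected_set D :=
  [forall A : {set G}, [&& A \subset D, A != set0 & A != D] ==>
     [exists x in A, exists y in D :\: A, adj x y]].

(** For [D] inside [S], this makes [D] a union of components of [S]. *)
Definition closed_in D S :=
  {in D & S, forall x y, adj x y -> y \in D}.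

Lemma connected_edge A D :
  connected_set D -> A \subset D -> A != set0 -> A != D ->
  exists x y, [/\ x \in A, y \in D, y \notin A & adj x y].
Proof.
move=> /forallP/(_ A)/implyP cD AD A0 nAD.
have /exists_inP[x xA /exists_inP[y]] := cD (introT and3P (And3 AD A0 nAD)).
by rewrite inE => /andP[yA yD] xy; exists x, y.
Qed.

(** No edge joins [A] to the rest of [S], so both sides can use the same [k] colors. *)
Lemma colorable_split A S k :
  A \subset S -> closed_in A S -> col A k -> col (S :\: A) k -> col S k.
Proof.
move=> AS clA /colorable_inducedP[c [ck cP]] /colorable_inducedP[d [dk dP]].
apply/colorable_inducedP; exists (fun x => if x \in A then c x else d x).
split=> [x xS|x y xS yS xy].
  by case: ifPn => xA; [exact: ck | apply: dk; rewrite inE xA].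
have [xA|xA] := boolP (x \in A); first by rewrite (clA x y) // cP // (clA x y).
have yA : y \notin A.
  by apply: contra xA => yA; apply: (clA y x) => //; rewrite adj_sym.
by rewrite (negPf yA) dP // inE ?xA ?yA.
Qed.

(** Induction on the size of [S]: a cut without crossing edges has two closed sides, and one of them
    is still not [k]-colorable. *)
Lemma noncolorable_component S k : ~~ col S k ->
  exists D, [/\ D \subset S, closed_in D S, connected_set D & ~~ col D k].
Proof.
have [m] := ubnP #|S|; elim: m S => // m IH S; rewrite ltnS => Sm nS.
have [cS|] := boolP (connected_set S); first by exists S; split=> // x y.
rewrite negb_forall => /existsP[A]; rewrite negb_imply.
case/andP=> /and3P[AS A0 nAS] noedge.
have clA : closed_in A S.
  move=> x y xA yS xy; apply: contraNT noedge => yA.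
  by apply/exists_inP; exists x => //; apply/exists_inP; exists y; rewrite ?inE ?yA.
have clB : closed_in (S :\: A) S.
  move=> x y; rewrite inE => /andP[xA xS] yS xy; rewrite inE yS andbT.
  by apply: contra xA => yA; apply: (clA y x) => //; rewrite adj_sym.
have step B : B \proper S -> closed_in B S -> ~~ col B k ->
    exists D, [/\ D \subset S, closed_in D S, connected_set D & ~~ col D k].
  move=> BS clBS nB.
  have [||D [DB clD cD nD]] := IH B => //.
    exact: leq_trans (proper_card BS) Sm.
  exists D; split=> //; first exact: subset_trans DB (proper_sub BS).
  move=> x y xD yS xy; apply: (clD x) => //.
  by apply: (clBS x) => //; apply: (subsetP DB).
have [kA|] := boolP (col A k); last first.
  by apply: step => //; rewrite properEneq nAS.
apply: step clB _; last by apply: contra nS; apply: colorable_split kA.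
rewrite properEneq subsetDl andbT; apply: contra A0 => /eqP SA.
rewrite -subset0; apply/subsetP => x xA.
by have := subsetP AS x xA; rewrite -SA inE xA.
Qed.

(** * Induced paths *)

Definition nbh v : {set G} := [set x | adj v x].

Definition induced_path n (p : nat -> G) : Prop :=
  forall i j, i < n -> j < n ->
    (p i == p j) = (i == j) /\
    adj (p i) (p j) = (i.+1 == j) || (j.+1 == i).

Lemma induced_path_cons n p v : 0 < n -> induced_path n p -> adj v (p 0) ->
  (forall i, 0 < i < n -> ~~ adj v (p i) && (v != p i)) ->
  induced_path n.+1 (fun i => if i is j.+1 then p j else v).
Proof.
move=> n0 pP vp0 vp.
have vpE j : j < n -> (v == p j) = false /\ adj v (p j) = (j == 0).
  case: j => [|j] jn; first by split=> //; apply: contraTF vp0 => /eqP->;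
    rewrite adj_irrefl.
  by have /andP[/negPf-> /negPf->] := vp j.+1 jn.
case=> [|i] [|j] //=; rewrite ?ltnS => ilt jlt.
- by rewrite eqxx adj_irrefl.
- by have [-> ->] := vpE j jlt; rewrite eqSS eq_sym orbF.
- by rewrite eq_sym adj_sym; have [-> ->] := vpE i ilt; rewrite eqSS eq_sym.
- by rewrite !eqSS; apply: pP.
Qed.

Lemma induced_path_embeds n p : induced_path n p -> embeds [set: G] (path_graph n).
Proof.
move=> pP; exists (fun i : 'I_n => p i); split=> [i j /eqP|//|i j].
  by have [-> _] := pP i j (ltn_ord i) (ltn_ord j); move=> /eqP/val_inj.
by have [_ ->] := pP i j (ltn_ord i) (ltn_ord j).
Qed.

(** * The Gyarfas path argument *)

Section Gyarfas.
Variables (S : {set G}) (g : nat).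
Hypothesis nbhDP : {in S &, forall u v, adj u v -> col (S :&: (nbh u :\: nbh v)) g}.

(** The path starts [v], [u] and continues in [C]. A step replaces [v], [u], [C] by [u], [z], [D],
    where [D] is a component of [C :\: nbh u] needing many colors and [z] is a neighbor of [u] in
    [C] that is attached to [D]. *)
Lemma grow_induced_path k v u C :
  v \in S -> u \in S -> C \subset S -> adj v u ->
  {in C, forall x, ~~ adj v x && (v != x)} ->
  (exists2 x, x \in C & adj u x) -> connected_set C -> ~~ col C (k * g) ->
  exists p, [/\ induced_path k.+3 p, p 0 = v, p 1 = u
              & forall i, 1 < i < k.+3 -> p i \in C].
Proof.
elim: k v u C => [|k IH] v u C vS uS CS vu vC [x xC ux] cC nC.
  have /andP[vx nvx] := vC x xC.
  have nvu : v != u by apply: contraTneq vu => ->; rewrite adj_irrefl.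
  have nux : u != x by apply: contraTneq ux => ->; rewrite adj_irrefl.
  exists (nth x [:: v; u; x]); split=> //; last by case=> [|[|[|]]].
  have E := (eqxx, adj_irrefl, vu, ux, negPf vx, negPf nvx, negPf nvu, negPf nux).
  by case=> [|[|[|//]]] [|[|[|//]]] _ _ /=; rewrite ?E // eq_sym adj_sym ?E.
have nD : ~~ col (C :\: nbh u) (k * g).
  apply: contra nC => kD; rewrite -(setID C (nbh u)) mulSn.
  apply: colorable_setU kD; apply: sub_colorable (nbhDP uS vS _) => //.
    apply/subsetP=> z; rewrite !inE => /andP[zC uz].
    by rewrite (subsetP CS) //= uz; have /andP[-> _] := vC z zC.
  by rewrite adj_sym.
have [D [DC clD cD {}nD]] := noncolorable_component nD.
have DC' z : z \in D -> z \in C /\ ~~ adj u z.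
  by move=> /(subsetP DC); rewrite !inE => /andP[-> ->].
(* [D] is a proper subset of the connected set [C], since [x] is a neighbor of [u] and [D] contains
   none. *)
have [y [z [yD zC zD yz]]] : exists y z, [/\ y \in D, z \in C, z \notin D & adj y z].
  apply: connected_edge => //.
  - exact: subset_trans DC (subsetDl _ _).
  - by apply: contraNneq nD => ->; apply: colorable_set0.
  - by apply: contraTneq xC => <-; apply: contraL ux => /DC'[].
(* Otherwise [z] would survive in [C :\: nbh u] and belong to the component [D]. *)
have uz : adj u z.
  by apply: contraR zD => uz; apply: (clD y) => //; rewrite !inE uz.
have [] := IH u z D uS (subsetP CS z zC) _ uz _ _ cD nD.
- by apply/subsetP=> t /DC'[tC _]; apply: (subsetP CS).
- move=> t /DC'[tC ->] /=; apply: contraTneq vu => ->.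
  by have /andP[] := vC t tC.
- by exists y; rewrite // adj_sym.
move=> p [pP p0 p1 pD].
have pC i : 0 < i < k.+3 -> p i \in C.
  case: i => [//|[|i]] ilt; first by rewrite p1.
  by have [] := DC' _ (pD i.+2 ilt).
exists (fun i => if i is j.+1 then p j else v); split=> //.
- apply: induced_path_cons => //; first by rewrite p0.
  by move=> i /pC/vC.
- by case=> [//|i]; rewrite !ltnS; apply: pC.
Qed.

Lemma colorable_nbh w v : 0 < w ->
  (forall K : {set G}, clique K -> #|K| <= w) -> v \in S ->
  col (S :&: nbh v) (w.-1 * g).
Proof.
move=> w0 wP vS; pose P (K : {set G}) := clique K && (K \subset S :&: nbh v).
have P0 : P set0.
  by rewrite /P sub0set andbT; apply/forall_inP=> x; rewrite inE.
case: (@maxset_exists _ P set0 P0) => K /maxsetP[/andP[cK KN] maxK] _.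
have KP x : x \in K -> x \in S /\ adj v x.
  by move=> /(subsetP KN); rewrite !inE => /andP[].
have extK x : x \notin K -> {in K, forall y, adj x y} -> clique (x |: K).
  move=> xK xA; apply/forall_inP=> y yK; apply/forall_inP=> z zK.
  apply/implyP; move: yK zK; rewrite !inE.
  case/predU1P=> [->|yK]; case/predU1P=> [->|zK]; rewrite ?eqxx // => yz.
  - exact: xA.
  - by rewrite adj_sym; apply: xA.
  - by have /forall_inP/(_ y yK)/forall_inP/(_ z zK)/implyP := cK; apply.
have vK : v \notin K by apply/negP=> /KP[_]; rewrite adj_irrefl.
(* Adding [v] to [K] gives a larger clique, which saves one. *)
have Kw : size (enum K) <= w.-1.
  have := wP _ (extK v vK (fun y yK => proj2 (KP y yK))).
  by rewrite cardsU1 vK -cardE; lia.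
have KF : {in enum K, forall y, col (S :&: (nbh v :\: nbh y)) g}.
  by move=> y; rewrite mem_enum => /KP[yS vy]; apply: nbhDP.
have := colorable_bigcup KF; apply: sub_colorable; last by rewrite leq_mul2r Kw orbT.
apply/subsetP=> x; rewrite !inE => /andP[xS vx].
(* A member of [K] is its own non-neighbor; any other [x] has one by maximality of [K]. *)
have [y yK yx] : exists2 y, y \in K & ~~ adj y x.
  have [xK|xK] := boolP (x \in K); first by exists x; rewrite ?adj_irrefl.
  apply/exists_inP; apply: contraR xK; rewrite negb_exists_in.
  move=> /forall_inP xA; have {}xA : {in K, forall y, adj x y}.
    by move=> y /xA; rewrite negbK adj_sym.
  apply/negPn/negP => xK; have /negP := xK; apply.
  rewrite -(maxK (x |: K)) ?setU11 ?subsetUr // /P extK //=.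
  by apply/subsetP=> z; rewrite !inE => /predU1P[->|/KP[-> ->]]; rewrite ?xS.
rewrite big_enum /=; apply/bigcupP; exists y => //.
by rewrite !inE xS vx yx.
Qed.

Lemma colorable_no_induced_path n w : 4 <= n -> 0 < g ->
  ~ embeds [set: G] (path_graph n) ->
  (forall K : {set G}, clique K -> #|K| <= w) ->
  col S ((n - 3) * w * g).
Proof.
move=> n4 g0 noP wP; case: (boolP (col S _)) => // nS; case: noP.
have [T [TS _ cT {}nS]] := noncolorable_component nS.
have [v vT] : exists v, v \in T.
  by apply/set0Pn; apply: contraNneq nS => ->; apply: colorable_set0.
have vS := subsetP TS v vT.
have w0 : 0 < w.
  rewrite -(cards1 v) wP //; apply/forall_inP=> x; rewrite inE => /eqP->.
  by apply/forall_inP=> y; rewrite inE => /eqP->; rewrite eqxx.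
have nD : ~~ col (T :\: nbh v) ((n - 3) * g).
  apply: contra nS => kD; rewrite -(setID T (nbh v)).
  have kN : col (T :&: nbh v) (w.-1 * g).
    by apply: sub_colorable (colorable_nbh w0 wP vS); rewrite ?setSI.
  apply: sub_colorable (colorable_setU kN kD) => //.
  (* The slack between the two factors of [g] is [(n - 4) * (w - 1)]. *)
  by rewrite -mulnDl leq_mul2r; apply/orP; right; nia.
have [D [DT clD cD {}nD]] := noncolorable_component nD.
have DT' z : z \in D -> z \in T /\ ~~ adj v z.
  by move=> /(subsetP DT); rewrite !inE => /andP[-> ->].
have D0 : D != set0 by apply: contraNneq nD => ->; apply: colorable_set0.
(* Removing [nbh v] leaves [v] itself, but isolated: a connected [D] containing it would be
   [[set v]], which is 1-colorable. *)
have vD : v \notin D.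
  apply: contra nD => vD; suff <- : [set v] = D by apply: colorable_set1; nia.
  apply/eqP/negPn/negP => nvD.
  have [||x [y [/set1P-> /DT'[_ /negP]]]] := connected_edge cD _ _ nvD.
  - by rewrite sub1set.
  - by apply/set0Pn; exists v; rewrite set11.
  - by move=> vy _ /vy.
have [y [z [yD zT zD yz]]] : exists y z, [/\ y \in D, z \in T, z \notin D & adj y z].
  apply: connected_edge => //; first exact: subset_trans DT (subsetDl _ _).
  by apply: contraNneq vD => ->.
have vz : adj v z.
  by apply: contraR zD => vz; apply: (clD y) => //; rewrite !inE vz.
have DS : D \subset S by apply/subsetP=> t /DT'[tT _]; apply: (subsetP TS).
have zS := subsetP TS z zT.
have [||p [pP _ _ _]] := grow_induced_path vS zS DS vz _ _ cD nD.
- move=> t tD; have [_ ->] := DT' t tD.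
  by apply: contraNneq vD => ->.
- by exists y; rewrite // adj_sym.
apply: (@induced_path_embeds n p).
by have <- : (n - 3).+3 = n by rewrite -addn3 subnK // ltnW.
Qed.

End Gyarfas.

(** * Induction on the size of the excluded clique-stable graph *)

Lemma embeds_clique_stableS m S u v : 0 < m -> u \in S -> v \in S -> adj u v ->
  embeds (S :&: (nbh u :\: nbh v)) (clique_stable_graph m) ->
  embeds S (clique_stable_graph m.+1).
Proof.
move=> m0 uS vS uv [f [f_inj fN f_adj]].
have fP a : [/\ f a \in S, adj u (f a) & ~~ adj v (f a)].
  by have := fN a; rewrite !inE => /and3P[-> -> ->].
(* [v] lies in [nbh u :\: nbh v], but is isolated there, unlike each [f a]. *)
have fv a : v != f a.
  have [b ab] : exists b, adj a b.
    by case: a => i; [exists (inr i) | exists (inl i)]; rewrite /= leqnn.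
  by have [_ _ vb] := fP b; apply: contraNneq vb => ->; rewrite f_adj.
have fu a : u != f a.
  by have [_ ufa _] := fP a; apply: contraTneq ufa => <-; rewrite adj_irrefl.
have nuv : u != v by apply: contraTneq uv => ->; rewrite adj_irrefl.
(* The last clique vertex goes to [u] and the last stable vertex to [v]; [unlift ord_max] passes the
   other indices to [f] with their values unchanged. *)
pose h (a : clique_stable_graph m.+1) := match a with
  | inl i => if unlift ord_max i is Some j then f (inl j) else u
  | inr i => if unlift ord_max i is Some j then f (inr j) else v
  end.
have fvE a : adj v (f a) = false by have [_ _ /negPf] := fP a.
have fuE a : adj u (f a) by have [] := fP a.
have h_inj : injective h.
  case=> i [] j; rewrite /h;
    case: unliftP => [i'|] ->; case: unliftP => [j'|] -> // /eqP;
    rewrite ?(inj_eq f_inj) ?[f _ == _]eq_sym ?[v == u]eq_sym;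
    rewrite ?(negPf (fu _)) ?(negPf (fv _)) ?(negPf nuv) //;
    by move=> /eqP [->].
have hS a : h a \in S.
  case: a => i; rewrite /h; case: unliftP => [j|] _ //; first by have [] := fP (inl j).
  by have [] := fP (inr j).
exists h; split=> //.
have bumpE (j : 'I_m) : bump m j = j by rewrite /bump leqNgt ltn_ord.
have ltm (j : 'I_m) : (m <= j) = false by rewrite leqNgt ltn_ord.
case=> i [] j; rewrite /h; case: unliftP => [i'|] ->; case: unliftP => [j'|] -> /=;
  rewrite ?f_adj ?adj_irrefl ?[adj (f _) _]adj_sym ?[adj v u]adj_sym ?uv ?fuE ?fvE //=;
  rewrite ?bumpE ?ltm ?leqnn ?(ltnW (ltn_ord _)) ?eqxx //;
  by rewrite ?(inj_eq lift_inj) ?[lift _ _ == ord_max]eq_sym ?neq_lift.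
Qed.

Lemma colorable_clique_stable_free n m w S : 4 <= n -> 0 < m ->
  ~ embeds [set: G] (path_graph n) ->
  (forall K : {set G}, clique K -> #|K| <= w) ->
  ~ embeds S (clique_stable_graph m) ->
  col S (((n - 3) * w) ^ m.-1).
Proof.
move=> n4 + noP wP.
elim: m S => // -[|m] IH S _ noKS /=.
  (* For [m = 1] the excluded graph is a single edge, so [S] is stable and one color suffices. *)
  apply/colorable_inducedP; exists (fun=> 0); split=> // u v uS vS uv; exfalso.
  apply: noKS; have nuv : u != v by apply: contraTneq uv => ->; rewrite adj_irrefl.
  exists (fun a => if a is inl _ then u else v); split.
  - case=> i [] j; rewrite ?(ord1 i) ?(ord1 j) // => /eqP.
      by rewrite (negPf nuv).
    by rewrite eq_sym (negPf nuv).
  - by case.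
  - by case=> i [] j; rewrite ?adj_irrefl ?(ord1 i) ?(ord1 j) //= adj_sym.
(* A vertex of [S] forces [w] to be positive, hence also the number of colors given by induction. *)
have [->|[v vS]] := set_0Vmem S; first exact: colorable_set0.
have w0 : 0 < w.
  rewrite -(cards1 v) wP //; apply/forall_inP=> x; rewrite inE => /eqP->.
  by apply/forall_inP=> y; rewrite inE => /eqP->; rewrite eqxx.
rewrite expnS; apply: colorable_no_induced_path => //; last first.
  by rewrite expn_gt0; apply/orP; left; nia.
move=> x y xS yS xy; apply: IH => //.
by move=> /(embeds_clique_stableS (ltn0Sn m) xS yS xy).
Qed.

End SetColoring.

(** * From vertex subsets to the whole graph *)

Theorem theorem1p5 (n : nat) (hn : 4 <= n) (G : sgraph)
  (hP : ~ has_induced G (path_graph n))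
  (hKS : ~ has_induced G (clique_stable_graph (uphalf n))) :
  chromatic_number G <=
    (n - 3) ^ (uphalf n - 1) * clique_number G ^ (uphalf n - 1).
Proof.
have noP : ~ embeds [set: G] (path_graph n) by move=> /embeds_has_induced.
have noKS : ~ embeds [set: G] (clique_stable_graph (uphalf n)).
  by move=> /embeds_has_induced.
have wP (K : {set G}) : clique K -> #|K| <= clique_number G.
  by move=> cK; apply: (@leq_bigmax_cond _ _ (fun K : {set G} => #|K|)).
have m0 : 0 < uphalf n by lia.
have := colorable_clique_stable_free hn m0 noP wP noKS.
rewrite -expnMn subn1 => /colorable_inducedP[c [ck cP]].
rewrite /chromatic_number; case: ex_minnP => k _; apply.
apply/existsP; exists [ffun x => Ordinal (ck x (in_setT x))].
apply/forallP=> x; apply/forallP=> y; apply/implyP=> xy.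
by rewrite !ffunE -val_eqE /=; apply: cP; rewrite ?in_setT.
Qed.
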